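(* Suppose that $b$ satisfies assumptions (A1)–(A4) of the context, let $Y$ be the solution of $Y_t=Y_0+\int_0^t b(s,Y_s)\,ds+Z_t$, $t\in[0,T]$, and let $\Lambda$ be the random variable such that $$|Z_t-Z_s|\le\Lambda|t-s|^\lambda,\qquad t,s\in[0,T].$$ Then, for any $r>0$: 1) there exist positive deterministic constants $M_1(r,T)$ and $M_2(r,T)$ such that $$|Y_t|^r\le M_1(r,T)+M_2(r,T)\Lambda^r,\qquad t\in[0,T];$$ 2) additionally, if $\Lambda$ can be chosen in such a way that $\mathbb E\Lambda^r<\infty$, then $$\mathbb E\Big[\sup_{t\in[0,T]}|Y_t|^r\Big]<\infty.$$
   Context: Fix $T\in(0,\infty)$ and $\lambda\in(0,1)$. Let $\varphi:[0,T]\to\mathbb R$ be $\lambda$-Hölder continuous. For $a\ge 0$ let $\mathcal D_a := \{(t,y) : t\in[0,T],\ y\in(\varphi(t)+a,\infty)\}$. The initial value $Y_0$ is a deterministic constant with $Y_0>\varphi(0)$. The noise $Z=\{Z_t,\ t\in[0,T]\}$ is a stochastic process such that $Z_0=0$ a.s. and there is a random variable $\Lambda=\Lambda(\omega)\in(0,\infty)$ with $|Z_t-Z_s|\le\Lambda|t-s|^\lambda$ for all $t,s\in[0,T]$. All equations are understood pathwise. Assumptions on the drift $b$: (A1) $b:\mathcal D_0\to\mathbb R$ is continuous. (A2) For any $\varepsilon>0$ there is a constant $c_\varepsilon>0$ such that $|b(t,y_1)-b(t,y_2)|\le c_\varepsilon|y_1-y_2|$ for all $(t,y_1),(t,y_2)\in\mathcal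 D_\varepsilon$. (A3) There are positive constants $y_*$, $c$, $\gamma$ such that $b(t,y)\ge \frac{c}{(y-\varphi(t))^\gamma}$ for all $(t,y)\in\mathcal D_0\setminus\mathcal D_{y_*}$. (A4) The constant $\gamma$ from (A3) satisfies $\gamma>\frac{1-\lambda}{\lambda}$. Under (A1)–(A4) the equation has a unique continuous solution $Y$ on $[0,T]$, and $Y_t>\varphi(t)$ for all $t\in[0,T]$. *)

(* Defs.v *)
From HB Require Import structures.
From mathcomp Require Import all_boot all_order all_algebra.
From mathcomp Require Import all_classical all_reals all_analysis.

Set Implicit Arguments.
Unset Strict Implicit.
Unset Printing Implicit Defensive.

Import Order.TTheory GRing.Theory Num.Theory.
Import numFieldNormedType.Exports.

Local Open Scope classical_set_scope.
Local Open Scope ring_scope.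

Definition holder_with (R : realType) (T lambda K : R) (f : R -> R) : Prop :=
  forall t s : R, t \in `[0, T] -> s \in `[0, T] ->
    `|f t - f s| <= K * `|t - s| `^ lambda.

Definition holder_continuous (R : realType) (T lambda : R) (f : R -> R) : Prop :=
  exists K : R, holder_with T lambda K f.

Definition domD (R : realType) (T : R) (phi : R -> R) (a : R) : set (R * R) :=
  [set p | p.1 \in `[0, T] /\ phi p.1 + a < p.2].

(* The drift is a total function on R * R; only its values on
   [domD T phi 0] matter, here and below. *)
Definition drift_continuous (R : realType) (T : R) (phi : R -> R)
    (b : R * R -> R) : Prop :=
  {within domD T phi 0, continuous b}.

Definition drift_lipschitz (R : realType) (T : R) (phi : R -> R)
    (b : R * R -> R) : Prop :=
  forall eps : R, 0 < eps -> exists2 c : R, 0 < c &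
    forall t y1 y2 : R,
      domD T phi eps (t, y1) -> domD T phi eps (t, y2) ->
      `|b (t, y1) - b (t, y2)| <= c * `|y1 - y2|.

Definition drift_explodes (R : realType) (T : R) (phi : R -> R)
    (b : R * R -> R) (ystar c gamma : R) : Prop :=
  forall t y : R, (domD T phi 0 `\` domD T phi ystar) (t, y) ->
    c / (y - phi t) `^ gamma <= b (t, y).

(* [b] is only meaningful on [domD T phi 0], so a solution path is required to
   stay above [phi]; the integrand is then continuous on [0, T], so that the
   Lebesgue integral is the ordinary one. *)
Definition solution_path (R : realType) (T : R) (phi : R -> R)
    (b : R * R -> R) (y0 : R) (z y : R -> R) : Prop :=
  [/\ {within `[0, T], continuous y},
      forall t : R, t \in `[0, T] -> phi t < y t &
      forall t : R, t \in `[0, T] ->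
        y t = y0 + \int[lebesgue_measure]_(s in `[0, t]) b (s, y s) + z t].

(* Processes are families indexed by all of R, of which only the restriction to
   [0, T] is constrained. *)
Definition holder_bound (R : realType) (d : measure_display)
    (Omega : measurableType d) (P : probability Omega R) (T lambda : R)
    (Z : R -> {RV P >-> R}) (Lambda : {RV P >-> R}) : Prop :=
  forall w : Omega,
    0 < Lambda w /\ holder_with T lambda (Lambda w) (fun t => Z t w).

(* The equation is required almost surely because [Z 0 = 0] is: it cannot hold
   with a deterministic initial value where [Z 0] does not vanish. *)
Definition solution (R : realType) (d : measure_display)
    (Omega : measurableType d) (P : probability Omega R) (T : R)
    (phi : R -> R) (b : R * R -> R) (y0 : R) (Z Y : R -> {RV P >-> R}) : Prop :=
  {ae P, forall w, solution_path T phi b y0 (fun t => Z t w) (fun t => Y t w)}.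

(* Main.v *)
Require Import Defs.
From HB Require Import structures.
From mathcomp Require Import all_boot all_order all_algebra.
From mathcomp Require Import all_classical all_reals all_analysis.
From mathcomp Require Import measurable_realfun ring lra.

(** Only large values of [Y] need work, because [Y] stays above the bounded
curve [phi]. Away from the singularity, on [{y >= phi t + 1}], the Lipschitz
condition together with continuity along the compact curve [t |-> phi t + 1]
gives the drift at most linear growth, [`|b (t, y)| <= A * (1 + `|y|)]
(lemma [drift_linear_growth]).

Fix a path and a time [t], and let [tau] be the last time before [t] at which
the path is not above [phi + 1], or [0] if it always is
([last_nonpos_time]). At [tau] the path is bounded by a constant that depends
on [y0] and [phi] only. On [`]tau, t]] the drift contributes at most
[A * T + A * \int_0^t `|Y|], and the noise at most [Lambda * T `^ lambda].
Hence [`|Y t| <= K + Lambda * T `^ lambda + A * \int_0^t `|Y|] for every [t],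
and Gronwall's inequality ([gronwall]) gives a bound affine in [Lambda] with
deterministic coefficients ([solution_path_bound]). Raising it to the power
[r] with [(u + v) `^ r <= (2 * u) `^ r + (2 * v) `^ r] proves the first claim.

The bound is uniform in [t], so it also bounds the supremum over [t]. That
supremum of uncountably many random variables need not be measurable, so the
comparison of integrals in the second claim is made with a measurable upper
bound only ([ae_ge0_le_integral_measurable_bound]). *)

Import Order.TTheory GRing.Theory Num.Theory.
Import numFieldNormedType.Exports.

Local Open Scope classical_set_scope.
Local Open Scope ring_scope.

(** * Continuity on compact intervals *)

Lemma holder_within_continuous (R : realType) (T lambda K : R) (f : R -> R) :
  0 < lambda -> holder_with T lambda K f -> {within `[0, T], continuous f}.
Proof.
move=> lambda0 fK; apply/subspace_continuousP => x xT.
apply/cvgrPdist_le => e e0.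
(* The constant [K] may be zero or, on a degenerate interval, negative. *)
pose K' := `|K| + 1.
have K'0 : 0 < K' by rewrite ltr_wpDl.
pose del := (e / K') `^ lambda^-1.
have del0 : 0 < del by rewrite powR_gt0// divr_gt0.
apply/nbhs_ballP; exists del => //= s xs sT.
apply: (le_trans (fK _ _ xT sT)).
have d_lt : `|x - s| < del by [].
apply: (@le_trans _ _ (K' * (del `^ lambda))).
  apply: (@le_trans _ _ (K' * (`|x - s| `^ lambda))).
    by rewrite ler_wpM2r ?powR_ge0// (le_trans (ler_norm K))// lerDl.
  by rewrite ler_pM2l// ge0_ler_powR ?nnegrE// ltW.
rewrite /del -powRrM mulVf ?lt0r_neq0// powRr1; last exact/ltW/divr_gt0.
by rewrite mulrC divfK// lt0r_neq0.
Qed.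

(** The start of the last excursion of [g] above zero before time [t]. The set
where [g] is nonpositive is compact, so it has a largest element; when it is
empty the excursion starts at [0], where nothing is claimed on the sign of
[g]. *)
Lemma last_nonpos_time (R : realType) (g : R -> R) (t : R) :
  0 <= t -> {within `[0, t], continuous g} ->
  exists2 tau, tau \in `[0, t] &
    (tau = 0 \/ g tau <= 0) /\ forall s, s \in `]tau, t] -> 0 < g s.
Proof.
move=> t0 gc.
pose S := (g @^-1` [set x : R | x <= 0]) `&` `[0, t].
have Sc : compact S.
  apply: (subclosed_compact _ (@segment_compact _ 0 t)); last exact: subIsetr.
  rewrite /S closed_setIS; last exact: itv_closed.
  by move/continuous_closedP : gc; apply; exact: closed_le.
have [S0|/set0P S0] := eqVneq S set0.
  exists 0; first by rewrite in_itv/= lexx.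
  split; first by left.
  move=> s; rewrite in_itv/= => /andP[s0 st]; rewrite ltNge; apply/negP => gs.
  have : S s by split => //=; rewrite in_itv/= st ltW.
  by rewrite S0.
have [tau tauS taumax] := @compact_EVT_max _ R id S S0 Sc (@continuous_subspaceT _ _ S id (fun x => cvg_id)).
move: tauS; rewrite inE => -[gtau tau0t].
exists tau => //; split; first by right.
move=> s; rewrite in_itv/= => /andP[taus st]; rewrite ltNge; apply/negP => gs.
have Ss : S s.
  split => //=; rewrite in_itv/= st andbT (le_trans _ (ltW taus))//.
  by move: tau0t; rewrite /= in_itv/= => /andP[].
by have := taumax s (mem_set Ss); rewrite leNgt taus.
Qed.

Lemma within_continuous_bounded (R : realType) (a b : R) (f : R -> R) :
  {within `[a, b], continuous f} ->
  exists2 M, 0 <= M & forall t, t \in `[a, b] -> `|f t| <= M.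
Proof.
move=> fc; have [ab|ba] := leP a b; last first.
  exists 0 => // t; rewrite in_itv/= => /andP[at_ tb].
  by have := le_lt_trans (le_trans at_ tb) ba; rewrite ltxx.
have [c _ cM] := @EVT_max _ (fun t => `|f t|) a b ab
  (fun x => cvg_norm (fc x)).
by exists `|f c|.
Qed.

(** * The drift along paths above the boundary *)

Lemma drift_path_continuous (R : realType) (T : R) (phi : R -> R)
    (b : R * R -> R) (y : R -> R) :
  drift_continuous T phi b -> {within `[0, T], continuous y} ->
  (forall t, t \in `[0, T] -> phi t < y t) ->
  {within `[0, T], continuous (fun s => b (s, y s))}.
Proof.
move=> /subspace_continuousP bc /subspace_continuousP yc phiy.
apply/subspace_continuousP => x xT.
have Dx : domD T phi 0 (x, y x) by split => //=; rewrite addr0 phiy.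
apply: (@cvg_comp _ _ _ (fun s => (s, y s)) b _ _ _ _ (bc _ Dx)).
move=> A /= [[A1 A2] /= [A1x A2y] AA].
have := yc _ xT _ A2y; rewrite /nbhs/= /within/= => yA2.
near=> s => sT; apply: (AA (s, y s)).
  split => /=; last by move: sT; near: s.
  by near: s.
by split => //=; rewrite addr0 phiy.
Unshelve. all: by end_near. Qed.

(** The Lipschitz condition compares [b (t, y)] with [b (t, phi t + 1)], and the
latter is bounded because it is continuous in [t]. The strip of width [1] around
the boundary is excluded since the drift may explode there. *)
Lemma drift_linear_growth (R : realType) (T : R) (phi : R -> R)
    (b : R * R -> R) :
  {within `[0, T], continuous phi} ->
  drift_continuous T phi b -> drift_lipschitz T phi b ->
  exists2 A, 0 < A & forall t y, t \in `[0, T] -> phi t + 1 <= y ->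
    `|b (t, y)| <= A * (1 + `|y|).
Proof.
move=> phic bc blip.
have phi1c : {within `[0, T], continuous (fun t => phi t + 1)}.
  by move=> x; apply: cvgD; [exact: phic|exact: cvg_cst].
have [|M M0 bM] := @within_continuous_bounded _ 0 T (fun s => b (s, phi s + 1)).
  by apply: (@drift_path_continuous _ _ phi) => // t _; rewrite ltrDl.
have [N N0 phiN] := @within_continuous_bounded _ _ _ _ phi1c.
(* The domains are strict epigraphs: a margin below [1] puts the reference curve
   [phi + 1] itself inside the domain. *)
have [L L0 bL] := blip 2^-1 (eqbRL (invr_gt0 _) (ltr0Sn _ _)).
exists (M + L * (1 + N)).
  by rewrite ltr_wpDl// mulr_gt0// ltr_wpDr.
move=> t y tT ty.
have D1 : domD T phi 2^-1 (t, phi t + 1) by split => //=; rewrite ltrD2l; lra.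
have D2 : domD T phi 2^-1 (t, y).
  by split => //=; apply: lt_le_trans ty; rewrite ltrD2l; lra.
have h1 := bL _ _ _ D2 D1.
have h2 := bM _ tT.
have h3 := phiN _ tT.
have h4 := ler_normB y (phi t + 1).
have h5 := ler_normD (b (t, y) - b (t, phi t + 1)) (b (t, phi t + 1)).
rewrite subrK in h5.
have y0 := normr_ge0 y.
apply: (le_trans h5).
have h6 : L * `|y - (phi t + 1)| <= L * (`|y| + N).
  by rewrite ler_pM2l//; apply: le_trans h4 _; rewrite lerD2l.
apply: (le_trans (lerD (le_trans h1 h6) h2)).
have My := mulr_ge0 M0 y0; have LNy := mulr_ge0 (mulr_ge0 (ltW L0) N0) y0.
by rewrite -subr_ge0; lra.
Qed.

(** * Gronwall's inequality *)

Lemma within_continuous_itv_integrable (R : realType) (a b : R) (f : R -> R) :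
  {within `[a, b], continuous f} ->
  lebesgue_measure.-integrable `[a, b] (EFin \o f).
Proof. by apply: continuous_compact_integrable; exact: segment_compact. Qed.

Lemma Rintegral_expR_le (R : realType) (k t : R) : 0 < k -> 0 <= t ->
  \int[lebesgue_measure]_(s in `[0, t]) expR (k * s) <= expR (k * t) / k.
Proof.
move=> k0; rewrite le_eqVlt => /predU1P[<-|t0].
  by rewrite set_itv1 Rintegral_set1 divr_ge0 ?expR_ge0 ?ltW.
have dF (x : R) : is_derive x (1 : R) (fun s : R => expR (k * s) / k) (expR (k * x)).
  apply: is_derive_eq; rewrite /= !scaler1 ?scaler0 ?add0r ?addr0.
  rewrite /GRing.scale/=; field; exact: lt0r_neq0.
rewrite /Rintegral (@continuous_FTC2 _ _ (fun s => expR (k * s) / k)) //=.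
- by rewrite gerBl divr_ge0 ?expR_ge0 ?ltW.
- apply: continuous_subspaceT => x.
  apply: (@continuous_comp _ _ _ ( *%R k) expR); last exact: continuous_expR.
  exact: mulrl_continuous.
- have dc x : {for x, continuous (fun s : R => expR (k * s) / k)}.
    by apply/differentiable_continuous/derivable1_diffP; apply: ex_derive.
  split => //.
  + by apply: cvg_at_right_filter; exact: dc.
  + by apply: cvg_at_left_filter; exact: dc.
- by move=> x _; rewrite derive1E; exact: derive_val.
Qed.

(** The weight [expR (- (2 * A) * s)] turns the integral inequality into a
contraction: if the weighted function is maximal at [m] with value [W], then
[A * \int_0^m f] is at most half of [f m], whence [f m / 2 <= K]. This costs
a factor two in the constants, compared with the sharp [K * expR (A * t)]. *)
Lemma gronwall (R : realType) (T K A : R) (f : R -> R) :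
  0 <= T -> 0 < A -> {within `[0, T], continuous f} ->
  (forall t, t \in `[0, T] ->
    f t <= K + A * \int[lebesgue_measure]_(s in `[0, t]) f s) ->
  forall t, t \in `[0, T] -> 0 <= f t -> f t <= 2 * K * expR (2 * A * t).
Proof.
move=> T0 A0 fc fK.
pose w s : R := f s * expR (- (2 * A) * s).
have expc (k : R) : continuous (fun s : R => expR (k * s)).
  move=> x; apply: (@continuous_comp _ _ _ ( *%R k) expR);
    last exact: continuous_expR.
  exact: mulrl_continuous.
have wc : {within `[0, T], continuous w}.
  move=> x; apply: cvgM; first exact: fc.
  by apply: continuous_subspaceT; exact: expc.
have [m mT wm] := EVT_max T0 wc.
have fw s : f s = w s * expR (2 * A * s).
  by rewrite /w -mulrA -expRD mulNr addNr expR0 mulr1.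
move=> t tT ft0.
have wt0 : 0 <= w t by rewrite mulr_ge0 ?expR_ge0.
have wm0 : 0 <= w m by exact: le_trans wt0 (wm _ tT).
have /andP[m0 mT'] : 0 <= m <= T by move: mT; rewrite in_itv.
have sub : `[0, m] `<=` `[0, T].
  by apply: subset_itvl; rewrite bnd_simp.
have int_le : \int[lebesgue_measure]_(s in `[0, m]) f s <=
    w m * (expR (2 * A * m) / (2 * A)).
  apply: (@le_trans _ _ (\int[lebesgue_measure]_(s in `[0, m])
      (w m * expR (2 * A * s)))).
    apply: le_Rintegral => //.
    - by apply: within_continuous_itv_integrable; exact: continuous_subspaceW fc.
    - apply: within_continuous_itv_integrable; apply: continuous_subspaceT => x.
      by apply: cvgM; [exact: cvg_cst|exact: expc].
    - by move=> s /sub sT; rewrite fw ler_pM2r ?expR_gt0// wm.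
  rewrite RintegralZl//; last first.
    apply: within_continuous_itv_integrable; apply: continuous_subspaceT.
    exact: expc.
  by rewrite ler_wpM2l// Rintegral_expR_le// mulr_gt0.
have e0 := expR_gt0 (2 * A * m).
have e1 : 1 <= expR (2 * A * m).
  by rewrite -expR0 ler_expR !mulr_ge0// ltW.
have h : w m * expR (2 * A * m) <= 2 * K.
  have fm := fK _ mT; rewrite fw in fm.
  (* The rate [2 * A] is chosen so that this factor is one half. *)
  have half : A * (w m * (expR (2 * A * m) / (2 * A))) =
    w m * expR (2 * A * m) / 2 by field; exact: lt0r_neq0.
  have := int_le; rewrite -(ler_pM2l A0) half => int_le2.
  lra.
rewrite fw ler_pM2r ?expR_gt0//.
apply: le_trans h; apply: le_trans (wm _ tT) _.
by rewrite ler_peMr.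
Qed.

(** * Bounds on solution paths *)

(** Gronwall's inequality is applied to the norm of the path. Its hypothesis
holds at each [t] by restarting the equation at the last time the path was not
above [phi + 1], or at [0] if there is no such time, so that the drift is
estimated only away from its singularity. *)
Lemma solution_path_bound (R : realType) (T : R) (phi : R -> R)
    (b : R * R -> R) (y0 A C H : R) (z y : R -> R) :
  0 < A -> 0 <= C -> 0 <= H ->
  {within `[0, T], continuous phi} -> drift_continuous T phi b ->
  (forall t, t \in `[0, T] -> `|phi t| <= C) ->
  (forall t x, t \in `[0, T] -> phi t + 1 <= x ->
    `|b (t, x)| <= A * (1 + `|x|)) ->
  z 0 = 0 ->
  (forall t s, t \in `[0, T] -> s \in `[0, T] -> `|z t - z s| <= H) ->
  solution_path T phi b y0 z y ->
  forall t, t \in `[0, T] ->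
    `|y t| <= 2 * (`|y0| + C + 1 + H + A * T) * expR (2 * A * T).
Proof.
move=> A0 C0 H0 phic bc phiC bA z0 zH [yc phiy yE] t tT.
have /andP[t0 tT'] : 0 <= t <= T by move: tT; rewrite in_itv.
have T0 : 0 <= T := le_trans t0 tT'.
have normyc : {within `[0, T], continuous (fun s => `|y s|)}.
  by move=> x; apply: cvg_norm; exact: yc.
have K0 : 0 <= `|y0| + C + 1 + H + A * T.
  by rewrite !addr_ge0// mulr_ge0// ltW.
apply: (@le_trans _ _ (2 * (`|y0| + C + 1 + H + A * T) * expR (2 * A * t)));
  last first.
  by rewrite ler_wpM2l ?mulr_ge0// ler_expR ler_wpM2l// mulr_ge0// ltW.
apply: (gronwall _ _ _ _ _ T0 A0 normyc) => // {tT t0 tT'} t tT.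
have /andP[t0 tT'] : 0 <= t <= T by move: tT; rewrite in_itv.
have sub : `[0, t] `<=` `[0, T] by apply: subset_itvl; rewrite bnd_simp.
have gc : {within `[0, t], continuous (fun s => y s - (phi s + 1))}.
  apply: continuous_subspaceW sub _ => x; apply: cvgB; first exact: yc.
  by apply: cvgD; [exact: phic|exact: cvg_cst].
have [tau taut [tau_start above]] := last_nonpos_time _ _ _ t0 gc.
have tauT : tau \in `[0, T] by exact: sub.
have /andP[tau0 taut'] : 0 <= tau <= t by move: taut; rewrite in_itv.
have y_tau : `|y tau| <= `|y0| + C + 1.
  (* Either the path starts at [y0], or it lies between [phi] and [phi + 1]. *)
  case: tau_start => [->|ytau].
    have /yE -> : 0 \in `[0, T] by rewrite in_itv/= lexx.
    by rewrite set_itv1 Rintegral_set1 z0 !addr0 -addrA lerDl addr_ge0.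
  have := phiC _ tauT; rewrite ler_norml => /andP[phiC1 phiC2].
  have phitau := phiy _ tauT.
  have y00 := normr_ge0 y0.
  by rewrite ler_norml; apply/andP; split; lra.
have fint : lebesgue_measure.-integrable `[0, t]
    (EFin \o (fun s => b (s, y s))).
  apply: within_continuous_itv_integrable; apply: continuous_subspaceW sub _.
  exact: (drift_path_continuous _ _ phi).
have yint : lebesgue_measure.-integrable `[0, t] (EFin \o (fun s => `|y s|)).
  by apply: within_continuous_itv_integrable; apply: continuous_subspaceW sub _.
have y1c : {within `[0, t], continuous (fun s => 1 + `|y s|)}.
  apply: continuous_subspaceW sub _ => x.
  by apply: cvgD; [exact: cvg_cst|exact: normyc].
have hint : lebesgue_measure.-integrable `[0, t]
    (EFin \o (fun s => A * (1 + `|y s|))).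
  apply: within_continuous_itv_integrable => x.
  by apply: cvgM; [exact: cvg_cst|exact: y1c].
have sub' : `]tau, t] `<=` `[0, t] by apply: subset_itvr; rewrite bnd_simp.
have drift_le : `|\int[lebesgue_measure]_(s in `]tau, t]) b (s, y s)| <=
    A * T + A * \int[lebesgue_measure]_(s in `[0, t]) `|y s|.
  apply: (@le_trans _ _
    (\int[lebesgue_measure]_(s in `]tau, t]) (A * (1 + `|y s|)))).
    have fint' : lebesgue_measure.-integrable `]tau, t]
        (EFin \o (fun s => b (s, y s))) by apply: integrableS fint.
    apply: le_trans (le_normr_Rintegral _ _) _ => //.
    apply: le_Rintegral => //.
    - exact: integrable_abse fint'.
    - by apply: integrableS hint.
    - move=> s st; apply: bA; first exact/sub/sub'.
      by have := above _ st; rewrite subr_gt0 => /ltW.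
  rewrite -(Rintegral_itvB (a := BLeft 0) hint) ?bnd_simp//.
  apply: (@le_trans _ _ (\int[lebesgue_measure]_(s in `[0, t])
      (A * (1 + `|y s|)))).
    by rewrite gerBl Rintegral_ge0// => s _; rewrite mulr_ge0 ?addr_ge0// ltW.
  have cint : lebesgue_measure.-integrable `[0, t] (EFin \o (fun _ : R => 1 : R)).
    by apply: within_continuous_itv_integrable => x; exact: cvg_cst.
  rewrite RintegralZl//; last exact: within_continuous_itv_integrable.
  rewrite RintegralD// Rintegral_cst//= lebesgue_measure_itv/= lte_fin.
  rewrite mulrDr lerD2r ler_pM2l// mul1r.
  by case: ifPn => //= _; rewrite subr0.
have increment : y t - y tau =
    \int[lebesgue_measure]_(s in `]tau, t]) b (s, y s) + (z t - z tau).
  rewrite (yE _ tT) (yE _ tauT).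
  by rewrite -(Rintegral_itvB (a := BLeft 0) fint) ?bnd_simp//; ring.
rewrite -[y t](subrK (y tau)) increment.
apply: le_trans (ler_normD _ _) _.
have := ler_normD (\int[lebesgue_measure]_(s in `]tau, t]) b (s, y s))
  (z t - z tau).
have := zH _ _ tT tauT.
move: drift_le y_tau; lra.
Qed.

(** * Moments *)

(** Valid for every nonnegative exponent, including those below [1] where
convexity is not available: the sum is at most twice the larger term. *)
Lemma powRD_le (R : realType) (u v r : R) : 0 <= u -> 0 <= v -> 0 <= r ->
  (u + v) `^ r <= (2 * u) `^ r + (2 * v) `^ r.
Proof.
move=> u0 v0 r0; wlog uv : u v u0 v0 / u <= v.
  move=> wlg; have [/wlg|/ltW/wlg] := leP u v; first exact.
  by rewrite (addrC v) (addrC ((2 * v) `^ r)); exact.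
apply: (@le_trans _ _ ((2 * v) `^ r)); last by rewrite lerDr powR_ge0.
by apply: ge0_ler_powR; rewrite ?nnegrE ?addr_ge0 ?mulr_ge0//; lra.
Qed.

Import HBNNSimple.

(** The integral of a nonnegative function is a supremum over the simple
functions below it, each of which is almost everywhere below [g]; this is why
[f] may fail to be measurable. *)
Lemma ae_ge0_le_integral_measurable_bound (d : measure_display) (X : measurableType d)
    (R : realType) (mu : {measure set X -> \bar R}) (f g : X -> \bar R) :
  (forall x, 0 <= f x)%E -> (forall x, 0 <= g x)%E ->
  measurable_fun setT g -> {ae mu, forall x, (f x <= g x)%E} ->
  (\int[mu]_x f x <= \int[mu]_x g x)%E.
Proof.
move=> f0 g0 mg fg; rewrite ge0_integralTE//.
apply: ge_ereal_sup => _ [h hf <-]; rewrite -integralT_nnsfun.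
apply: ae_ge0_le_integral => //.
- by move=> x _ /=; rewrite lee_fin.
- exact/measurable_EFinP.
- by apply: filterS fg => x fgx _; exact: le_trans (hf x) fgx.
Qed.

Theorem theorem2p5 (R : realType) (T lambda : R)
  (hT : 0 < T) (hlambda0 : 0 < lambda) (hlambda1 : lambda < 1)
  (phi : R -> R) (hphi : holder_continuous T lambda phi)
  (y0 : R) (hy0 : phi 0 < y0)
  (b : R * R -> R) (ystar c gamma : R)
  (hA1 : drift_continuous T phi b)
  (hA2 : drift_lipschitz T phi b)
  (hystar : 0 < ystar) (hc : 0 < c) (hgamma : 0 < gamma)
  (hA3 : drift_explodes T phi b ystar c gamma)
  (hA4 : (1 - lambda) / lambda < gamma)
  (d : measure_display) (Omega : measurableType d) (P : probability Omega R)
  (Z : R -> {RV P >-> R})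
  (hZ0 : {ae P, forall w, Z 0 w = 0})
  (hZ : exists Lambda : {RV P >-> R}, holder_bound T lambda Z Lambda)
  (Y : R -> {RV P >-> R}) (hY : solution T phi b y0 Z Y)
  (r : R) (hr : 0 < r) :
  (exists M1 M2 : R, [/\ 0 < M1, 0 < M2 &
     forall Lambda : {RV P >-> R}, holder_bound T lambda Z Lambda ->
       {ae P, forall w, forall t : R, t \in `[0, T] ->
          `|Y t w| `^ r <= M1 + M2 * Lambda w `^ r}])
  /\
  ((exists2 Lambda : {RV P >-> R}, holder_bound T lambda Z Lambda &
      ('E_P[fun w => (Lambda w `^ r)%R] < +oo)%E) ->
   (\int[P]_w ereal_sup [set (`|Y t w| `^ r)%:E | t in `[0%R, T]] < +oo)%E).
Proof.
have [Kphi phiK] := hphi.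
have phic := holder_within_continuous _ _ _ _ _ hlambda0 phiK.
have [C C0 phiC] := within_continuous_bounded _ _ _ _ phic.
have [A A0 bA] := drift_linear_growth _ _ _ _ phic hA1 hA2.
pose E := 2 * expR (2 * A * T).
have E0 : 0 < E by rewrite mulr_gt0// expR_gt0.
pose u := (`|y0| + C + 1 + A * T) * E.
pose v := T `^ lambda * E.
have u0 : 0 < u by rewrite mulr_gt0// ltr_wpDr ?mulr_ge0 ?ltW// ltr_wpDl ?addr_ge0.
have v0 : 0 < v by rewrite mulr_gt0// powR_gt0.
have M10 : 0 < (2 * u) `^ r by rewrite powR_gt0// mulr_gt0.
have M20 : 0 < (2 * v) `^ r by rewrite powR_gt0// mulr_gt0.
have bound (Lambda : {RV P >-> R}) : holder_bound T lambda Z Lambda ->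
    {ae P, forall w, forall t : R, t \in `[0, T] ->
      `|Y t w| `^ r <= (2 * u) `^ r + (2 * v) `^ r * Lambda w `^ r}.
  move=> ZL; apply: filterS2 hZ0 hY => w Z0w Yw t tT.
  have [L0 ZwL] := ZL w.
  have ZH t1 s1 : t1 \in `[0, T] -> s1 \in `[0, T] ->
      `|Z t1 w - Z s1 w| <= Lambda w * T `^ lambda.
    move=> t1T s1T; apply: le_trans (ZwL _ _ t1T s1T) _.
    rewrite ler_pM2l// ge0_ler_powR ?nnegrE ?(ltW hT) ?(ltW hlambda0)//.
    move: t1T s1T; rewrite !in_itv/= => /andP[? ?] /andP[? ?].
    by rewrite ler_norml; apply/andP; split; lra.
  have H0 : 0 <= Lambda w * T `^ lambda by rewrite mulr_ge0 ?powR_ge0// ltW.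
  have Ytw := solution_path_bound _ _ _ _ _ _ _ _ _ _ A0 C0 H0 phic hA1 phiC bA
    Z0w ZH Yw _ tT.
  have v20 : 0 <= 2 * v by rewrite mulr_ge0// ltW.
  rewrite -(powRM r v20 (ltW L0)) -mulrA.
  apply: le_trans (powRD_le _ _ _ _ (ltW u0) (mulr_ge0 (ltW v0) (ltW L0)) (ltW hr)).
  apply: ge0_ler_powR; rewrite ?nnegrE ?(ltW hr)//.
    exact: addr_ge0 (ltW u0) (mulr_ge0 (ltW v0) (ltW L0)).
  by apply: le_trans Ytw _; rewrite /u /v /E le_eqVlt; apply/orP; left; apply/eqP; ring.
split; first by exists ((2 * u) `^ r), ((2 * v) `^ r).
move=> [Lambda ZL EL].
have mL : measurable_fun setT (fun w => (Lambda w `^ r)%:E).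
  by apply/measurable_EFinP; apply: (measurableT_comp (measurable_powR r)).
apply: (@le_lt_trans _ _ (\int[P]_w
    (((2 * u) `^ r)%:E + ((2 * v) `^ r)%:E * (Lambda w `^ r)%:E))%E).
  apply: ae_ge0_le_integral_measurable_bound.
  - move=> w; apply: (@le_trans _ _ (`|Y 0 w| `^ r)%:E).
      by rewrite lee_fin powR_ge0.
    by apply: ereal_sup_ubound; exists 0 => //=; rewrite in_itv/= lexx ltW.
  - by move=> w; rewrite -EFinM -EFinD lee_fin addr_ge0 ?mulr_ge0 ?powR_ge0.
  - apply: emeasurable_funD => //; exact: measurable_funeM.
  - apply: filterS (bound _ ZL) => w Yw.
    apply: ge_ereal_sup => _ [t tT <-]; rewrite -EFinM -EFinD lee_fin.
    exact: Yw.
rewrite ge0_integralD//; last 3 first.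
- by move=> w _; rewrite lee_fin ltW.
- by move=> w _; rewrite -EFinM lee_fin mulr_ge0 ?powR_ge0.
- exact: measurable_funeM.
rewrite integral_cst// [X in (_ * X + _)%E](_ : _ = 1%E) ?mule1; last exact: probability_setT.
rewrite ge0_integralZl_EFin ?powR_ge0//; last first.
  by move=> w _; rewrite lee_fin powR_ge0.
move: EL; rewrite unlock => EL.
rewrite lte_add_pinfty ?ltry// lte_mul_pinfty// lee_fin.
exact: ltW.
Qed.
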